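(* Let $q$ be a prime power, let $n$ be a positive integer, write $\vec{X}=(X_1,\ldots,X_n)$, and let $P(\vec{X})\in\mathbb{F}_q[\vec{X}]$ be a nonzero polynomial with $\deg_{X_i}P<q-1$ for $i=1,\ldots,n$. Let $m$ be the number of $\vec{x}\in(\mathbb{F}_q^\ast)^n$ with $P(\vec{x})\neq 0$. Then there does not exist any $(k_1,\ldots,k_n)\in\{0,1,\ldots,q-2\}^n$ such that $$\operatorname{Supp}\big(X_1^{k_1}\cdots X_n^{k_n}P(\vec{X}) \bmod \{X_1^{q-1}-1,\ldots,X_n^{q-1}-1\}\big)\cap U(q,m,n)=\emptyset.$$
   Context: $\mathbb{F}_q$ is the finite field with $q$ elements and $\mathbb{F}_q^\ast=\mathbb{F}_q\setminus\{0\}$. For a polynomial $F$, $\operatorname{Supp}(F)$ is the set of monomials occurring in $F$ with nonzero coefficient. For $F\in\mathbb{F}_q[X_1,\ldots,X_n]$, $F \bmod \{X_1^{q-1}-1,\ldots,X_n^{q-1}-1\}$ denotes the unique polynomial of degree less than $q-1$ in each variable that is congruent to $F$ modulo the ideal generated by $X_1^{q-1}-1,\ldots,X_n^{q-1}-1$ (i.e. exponents are reduced modulo $q-1$ into $\{0,\ldots,q-2\}$). For positive integers $m$ and $n$ define $$\mathcal{M}(q,n)=\{X_1^{i_1}\cdots X_n^{i_n}\mid 0\le i_1,\ldots,i_n<q-1\},$$ $$U(q,m,n)=\Big\{X_1^{i_1}\cdots X_n^{i_n}\in\mathcal{M}(q,n)\ \Big|\ \prod_{s=1}^n(q-1-i_s)\le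 m\Big\}.$$ *)

(* Defs.v *)
From HB Require Import structures.
From mathcomp Require Export all_boot all_order all_algebra.
From mathcomp.multinomials Require Import ssrcomplements.
From mathcomp.multinomials Require Export mpoly.

Set Implicit Arguments.
Unset Strict Implicit.
Unset Printing Implicit Defensive.

Import GRing.Theory.
Local Open Scope ring_scope.

(* A monomial X_1^{i_1} ... X_n^{i_n} is represented by its exponent vector
   in 'X_{1..n}, and Supp(F) by msupp F. *)

(* deg_{X_i} p; the zero polynomial gets degree 0. *)
Definition mdeg_in (R : nzRingType) (n : nat) (i : 'I_n) (p : {mpoly R[n]}) :
    nat :=
  (\max_(mon <- msupp p) mon i)%N.

Definition monM (q n : nat) : {pred 'X_{1..n}} :=
  [pred mon : 'X_{1..n} | [forall i, (mon i < q.-1)%N]].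
Arguments monM : clear implicits.

Definition monU (q m n : nat) : {pred 'X_{1..n}} :=
  [pred mon : 'X_{1..n} |
     (mon \in monM q n) && (\prod_(s < n) (q.-1 - mon s) <= m)%N].
Arguments monU : clear implicits.

Definition mnm_red (q n : nat) (mon : 'X_{1..n}) : 'X_{1..n} :=
  [multinom (mon i %% q.-1)%N | i < n].

(* p mod {X_1^{q-1} - 1, ..., X_n^{q-1} - 1}, computed by reducing exponents;
   mdeg_in_red, congr_red and mpoly_red_unique identify it, for q > 1, as the
   unique polynomial of degree < q - 1 in each variable that is congruent to p
   modulo the ideal generated by the X_i^{q-1} - 1. *)
Definition mpoly_red (R : nzRingType) (q n : nat) (p : {mpoly R[n]}) :
    {mpoly R[n]} :=
  \sum_(mon <- msupp p) p@_mon *: 'X_[mnm_red q mon].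

Definition congr_cyc (R : comNzRingType) (q n : nat) (p r : {mpoly R[n]}) :
    Prop :=
  exists A : 'I_n -> {mpoly R[n]},
    p - r = \sum_(i < n) A i * ('X_i ^+ q.-1 - 1).

Lemma mdeg_in_ltP (R : nzRingType) (n d : nat) (i : 'I_n) (p : {mpoly R[n]}) :
  (0 < d)%N ->
  reflect {in msupp p, forall mon : 'X_{1..n}, (mon i < d)%N}
          (mdeg_in i p < d)%N.
Proof.
case: d => // d _; rewrite ltnS.
apply: (iffP (bigmax_leqP_seq _ _ _ _)) => H mon mi; first exact: H.
by move=> _; apply: H.
Qed.

Lemma mpoly_red_widen (R : nzRingType) (q n k : nat) (p : {mpoly R[n]}) :
  (msize p <= k)%N ->
  mpoly_red q p = \sum_(mon : 'X_{1..n < k}) p@_mon *: 'X_[mnm_red q mon].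
Proof.
move=> le_pk; rewrite /mpoly_red.
pose I : subFinType _ := 'X_{1..n < k}.
rewrite (big_mksub I) //=; first last.
- by move=> x /msize_mdeg_lt /leq_trans; apply.
- by rewrite msupp_uniq.
by rewrite big_rmcond //= => j /memN_msupp_eq0 ->; rewrite scale0r.
Qed.

Lemma mpoly_red_is_additive (R : nzRingType) (q n : nat) :
  zmod_morphism (@mpoly_red R q n).
Proof.
move=> p r; pose k := maxn (msize (p - r)) (maxn (msize p) (msize r)).
rewrite !(@mpoly_red_widen R q n k) ?leq_max ?leqnn ?orbT // -sumrB.
by apply: eq_bigr => m _; rewrite mcoeffB scalerBl.
Qed.

HB.instance Definition _ (R : nzRingType) (q n : nat) :=
  GRing.isZmodMorphism.Build {mpoly R[n]} {mpoly R[n]} (@mpoly_red R q n)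
    (@mpoly_red_is_additive R q n).

Lemma mpoly_redZX (R : nzRingType) (q n : nat) (c : R) (mon : 'X_{1..n}) :
  mpoly_red q (c *: 'X_[mon]) = c *: 'X_[mnm_red q mon].
Proof.
have [->|nz_c] := eqVneq c 0; first by rewrite !scale0r raddf0.
by rewrite /mpoly_red msuppMCX // big_seq1 mcoeffZ mcoeffX eqxx mulr1.
Qed.

Lemma mpoly_red_id (R : nzRingType) (q n : nat) (p : {mpoly R[n]}) :
  (forall i, (mdeg_in i p < q.-1)%N) -> mpoly_red q p = p.
Proof.
move=> Hp; rewrite [RHS]mpolyE /mpoly_red big_seq [RHS]big_seq.
apply: eq_bigr => mon mp; congr (_ *: 'X_[_]); apply/mnmP => i.
rewrite mnmE modn_small //.
have d0 : (0 < q.-1)%N by apply: leq_ltn_trans (Hp i).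
by have /(mdeg_in_ltP _ _ d0) := Hp i; apply.
Qed.

Lemma mdeg_in_red (R : nzRingType) (q n : nat) (p : {mpoly R[n]}) (i : 'I_n) :
  (1 < q)%N -> (mdeg_in i (mpoly_red q p) < q.-1)%N.
Proof.
case: q => [|[|q]] // _; apply/mdeg_in_ltP => // mon /msupp_sum_le.
rewrite filter_predT => /flatten_mapP[m _ /msuppZ_le].
by rewrite msuppX inE => /eqP->; rewrite mnmE ltn_mod.
Qed.

Lemma congr_cyc0 (R : comNzRingType) (q n : nat) (p : {mpoly R[n]}) :
  congr_cyc q p p.
Proof.
by exists (fun=> 0); rewrite subrr big1 // => i _; rewrite mul0r.
Qed.

Lemma congr_cycD (R : comNzRingType) (q n : nat) (p1 r1 p2 r2 : {mpoly R[n]}) :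
  congr_cyc q p1 r1 -> congr_cyc q p2 r2 -> congr_cyc q (p1 + p2) (r1 + r2).
Proof.
move=> [A1 e1] [A2 e2]; exists (fun i => A1 i + A2 i).
rewrite opprD addrACA e1 e2 -big_split.
by apply: eq_bigr => i _; rewrite mulrDl.
Qed.

Lemma congr_cycM (R : comNzRingType) (q n : nat) (p1 r1 p2 r2 : {mpoly R[n]}) :
  congr_cyc q p1 r1 -> congr_cyc q p2 r2 -> congr_cyc q (p1 * p2) (r1 * r2).
Proof.
move=> [A1 e1] [A2 e2]; exists (fun i => A1 i * p2 + r1 * A2 i).
have -> : p1 * p2 - r1 * r2 = (p1 - r1) * p2 + r1 * (p2 - r2).
  by rewrite mulrBl mulrBr addrA subrK.
rewrite e1 e2 mulr_suml mulr_sumr -big_split.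
by apply: eq_bigr => i _; rewrite /= mulrDl mulrA -[_ * _ * p2]mulrA
  [_ * p2]mulrC mulrA.
Qed.

Lemma congr_red (R : comNzRingType) (q n : nat) (p : {mpoly R[n]}) :
  congr_cyc q p (mpoly_red q p).
Proof.
rewrite [X in congr_cyc _ X _]mpolyE /mpoly_red.
apply: (big_ind2 (@congr_cyc R q n)); [exact: congr_cyc0 | exact: congr_cycD |].
move=> mon _; rewrite -!mul_mpolyC; apply: congr_cycM; first exact: congr_cyc0.
rewrite !mpolyXE_id.
apply: (big_ind2 (@congr_cyc R q n)); [exact: congr_cyc0 | exact: congr_cycM |].
move=> i _; rewrite mnmE {1}(divn_eq (mon i) q.-1) exprD.
rewrite -[X in congr_cyc _ _ X]mul1r.
apply: congr_cycM; last exact: congr_cyc0.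
rewrite mulnC exprM; elim: (mon i %/ _)%N => [|k IHk]; first exact: congr_cyc0.
rewrite exprS -[1]mul1r; apply: congr_cycM => //.
exists (fun j => (j == i)%:R).
rewrite (bigD1 i) //= eqxx mul1r big1 ?addr0 // => j /negbTE->.
by rewrite mul0r.
Qed.

Lemma mpoly_red_unique (R : comNzRingType) (q n : nat) (p r : {mpoly R[n]}) :
  (forall i, (mdeg_in i r < q.-1)%N) -> congr_cyc q p r -> r = mpoly_red q p.
Proof.
move=> /mpoly_red_id red_r [A e]; rewrite -[LHS]red_r.
apply/esym/eqP; rewrite -subr_eq0 -(raddfB (@mpoly_red R q n)) e.
rewrite raddf_sum /=; apply/eqP/big1 => i _; rewrite [A i]mpolyE mulr_suml.
rewrite raddf_sum /=; apply: big1 => mon _.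
rewrite mulrBr mulr1 raddfB -scalerAl mpolyXn -mpolyXD /= !mpoly_redZX.
apply/eqP; rewrite subr_eq0; apply/eqP; congr (_ *: 'X_[_]); apply/mnmP => j.
rewrite !mnmE mulmnE mnm1E; case: (i == j); rewrite ?mul1n ?mul0n ?addn0 //.
by rewrite modnDr.
Qed.

(* Main.v *)
(** Footprint bound: a nonzero polynomial P in n + 1 variables is a polynomial
    of some degree d in the last one, with leading coefficient P_d.  Over every
    point of A^n where P_d does not vanish, P has at least |A| - d nonzeros in
    A, so by induction some monomial of P bounds the number of nonzeros of P on
    A^(n+1) from below by the product of the |A| - i_s.  Multiplying by X^k and
    reducing exponents modulo q - 1 does not change the number m of nonzeros on
    the torus, and m > 0 by the bound applied to P, so the reduced polynomial is
    nonzero and the bound applied to it yields a monomial in U(q,m,n). *)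

Require Import Defs.
From mathcomp Require Import all_boot all_order all_algebra.
From mathcomp Require Import finfield.
From mathcomp.multinomials Require Import mpoly.

Import GRing.Theory.
Local Open Scope ring_scope.

Section LastVariable.
Variables (R : comNzRingType) (n : nat).
Implicit Types (p : {mpoly R[n.+1]}) (mon : 'X_{1..n}).

Definition mnm_rcons mon (j : nat) : 'X_{1..n.+1} := [multinom of rcons mon j].

Lemma mnm_rcons_widen mon j (i : 'I_n) :
  mnm_rcons mon j (widen_ord (leqnSn n) i) = mon i.
Proof. by rewrite !(mnm_nth 0%N) nth_rcons size_tuple /= ltn_ord. Qed.

Lemma mnm_rcons_max mon j : mnm_rcons mon j ord_max = j.
Proof. by rewrite (mnm_nth 0%N) nth_rcons size_tuple /= ltnn eqxx. Qed.

Lemma mnm_rconsK (m : 'X_{1..n.+1}) :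
  mnm_rcons [multinom m (widen_ord (leqnSn n) i) | i < n] (m ord_max) = m.
Proof.
apply/mnmP => i; case: (unliftP ord_max i) => [k ->|->]; last first.
  by rewrite mnm_rcons_max.
have -> : lift ord_max k = widen_ord (leqnSn n) k.
  by apply: val_inj; rewrite /= /bump leqNgt ltn_ord.
by rewrite mnm_rcons_widen mnmE.
Qed.

(** Both sides expand over [msupp p], and a monomial [m] contributes to either side exactly when
    splitting off its last exponent gives [mon] and [j]. *)
Lemma mcoeff_muni p mon j : ((muni p)`_j)@_mon = p@_(mnm_rcons mon j).
Proof.
rewrite muniE coef_sum raddf_sum /= [in RHS](mpolyE p) raddf_sum /=.
apply: eq_bigr => m _; rewrite coefZ coefXn mulr_natr mcoeffMn.
rewrite !mcoeffZ !mcoeffX -[LHS]mulr_natr -mulrA -natrM mulnb.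
congr (_ * _%:R); congr nat_of_bool.
apply/andP/eqP => [[/eqP <- /eqP ->]|->]; first by rewrite mnm_rconsK.
split; last by rewrite mnm_rcons_max.
by apply/eqP/mnmP => i; rewrite mnmE mnm_rcons_widen.
Qed.

Lemma muni_neq0 p : p != 0 -> muni p != 0.
Proof.
apply: contra_neq => p0; apply/mpolyP => m.
by rewrite -(mnm_rconsK m) -mcoeff_muni p0 coef0 !mcoeff0.
Qed.

Lemma horner_muni p (x : 'I_n.+1 -> R) :
  (map_poly (meval (fun i => x (widen_ord (leqnSn n) i))) (muni p)).[x ord_max]
    = p.@[x].
Proof.
rewrite muniE mevalE rmorph_sum horner_sum; apply: eq_bigr => m _.
rewrite /= map_polyZ hornerZ map_polyXn hornerXn /= mevalZ mevalX big_ord_recr mulrA.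
by congr (_ * _ * _); apply: eq_bigr => i _; rewrite mnmE.
Qed.

End LastVariable.

Section Footprint.
Variables (F : finFieldType) (A : {set F}).

Definition grid_nonzeros (n : nat) (p : {mpoly F[n]}) : {set {ffun 'I_n -> F}} :=
  [set x : {ffun 'I_n -> F} | [forall i, x i \in A] && (p.@[x] != 0)].

(** A nonzero polynomial has at most [(size p).-1] roots in [A]; the truncated subtraction makes the
    bound trivial when the degree exceeds [#|A|]. *)
Lemma card_poly_nonzeros (p : {poly F}) :
  p != 0 -> (#|A| - (size p).-1 <= #|[set a in A | p.[a] != 0%R]|)%N.
Proof.
move=> p0; rewrite leq_subLR -(cardsID [set a | root p a] A).
apply: leq_add; last first.
  by apply/subset_leq_card/subsetP => a; rewrite !inE andbC.
rewrite -ltnS prednK ?size_poly_gt0 // cardE.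
apply: max_poly_roots => //; last exact: enum_uniq.
by apply/allP => a; rewrite mem_enum !inE => /andP[].
Qed.

(** Taking a pair lets one injectivity statement transport a count of pairs (base point, last
    coordinate) to the grid. *)
Definition ffun_rcons (n : nat) (u : {ffun 'I_n -> F} * F) :
    {ffun 'I_n.+1 -> F} :=
  [ffun i => if unlift ord_max i is Some j then u.1 j else u.2].

Lemma ffun_rcons_max n (u : {ffun 'I_n -> F} * F) : ffun_rcons n u ord_max = u.2.
Proof. by rewrite ffunE unlift_none. Qed.

Lemma ffun_rcons_lift n (u : {ffun 'I_n -> F} * F) i :
  ffun_rcons n u (lift ord_max i) = u.1 i.
Proof. by rewrite ffunE liftK. Qed.

Lemma ffun_rcons_widen n (u : {ffun 'I_n -> F} * F) i :
  ffun_rcons n u (widen_ord (leqnSn n) i) = u.1 i.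
Proof.
rewrite -ffun_rcons_lift; congr (ffun_rcons n u _).
by apply: val_inj; rewrite /= /bump leqNgt ltn_ord.
Qed.

Lemma ffun_rcons_inj n : injective (ffun_rcons n).
Proof.
move=> [y a] [z b] /ffunP yz; congr pair.
  by apply/ffunP => i; have := yz (lift ord_max i); rewrite !ffun_rcons_lift.
by have := yz ord_max; rewrite !ffun_rcons_max.
Qed.

Theorem footprint_bound (n : nat) (p : {mpoly F[n]}) : p != 0 ->
  exists2 mon, mon \in msupp p
    & (\prod_(s < n) (#|A| - mon s) <= #|grid_nonzeros n p|)%N.
Proof.
elim: n p => [|n IHn] p p0.
  (* Without variables, [p] is a nonzero constant, the product is empty and the grid is a single
     point. *)
  have mon0 (mon : 'X_{1..0}) : mon = 0%MM by apply/mnmP; case.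
  have p00 : p@_0 != 0.
    by apply: contra_neq p0 => p0; apply/mpolyP => mon; rewrite (mon0 mon) p0 mcoeff0.
  exists 0%MM; first by rewrite mcoeff_msupp.
  rewrite big_ord0 card_gt0; apply/set0Pn; exists [ffun=> 0]; rewrite inE.
  apply/andP; split; first by apply/forallP; case.
  have -> : p = (p@_0)%:MP.
    by apply/mpolyP => mon; rewrite (mon0 mon) mcoeffC eqxx mulr1.
  by rewrite mevalC.
pose Q := muni p; pose d := (size Q).-1.
have lc0 : Q`_d != 0 by rewrite -lead_coefE lead_coef_eq0 muni_neq0.
have [mon mon_lc le_mon] := IHn _ lc0.
exists (mnm_rcons n mon d).
  by move: mon_lc; rewrite !mcoeff_msupp mcoeff_muni.
(* [T y] is the fibre of nonzeros of [p] above the base point [y]. *)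
pose T (y : {ffun 'I_n -> F}) := [set a in A | (map_poly (meval y) Q).[a] != 0].
have T_ge y : y \in grid_nonzeros n Q`_d -> (#|A| - d <= #|T y|)%N.
  rewrite inE => /andP[_ yd].
  (* The coefficient of degree [d] survives at [y], and specialising cannot raise the degree above
     [d]. *)
  have Qy0 : map_poly (meval y) Q != 0.
    by apply: contra_neq yd => Qy0; rewrite -coef_map Qy0 coef0.
  apply: leq_trans (card_poly_nonzeros _ Qy0); apply: leq_sub2l.
  by rewrite /d -!subn1; apply: leq_sub2r; apply: size_poly.
rewrite big_ord_recr /= mnm_rcons_max.
under eq_bigr => i _ do rewrite mnm_rcons_widen.
apply: leq_trans (_ : \sum_(y in grid_nonzeros n Q`_d) #|T y| <= _)%N.
  apply: leq_trans (leq_mul le_mon (leqnn _)) _.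
  by rewrite -sum_nat_const; apply: leq_sum.
under eq_bigr => y _ do rewrite -sum1_card.
(* The sum of the fibre sizes counts pairs [(y, a)], which [ffun_rcons] embeds into the nonzeros of
   [p]. *)
rewrite pair_big_dep /= sum1dep_card -(card_imset _ (ffun_rcons_inj n)).
apply/subset_leq_card/subsetP => _ /imsetP[[y a] + ->].
rewrite !inE /= => /andP[/andP[/forallP yA _] /andP[aA ya0]].
apply/andP; split.
  apply/forallP => i; case: (unliftP ord_max i) => [j|] ->.
    by rewrite ffun_rcons_lift.
  by rewrite ffun_rcons_max.
rewrite -horner_muni ffun_rcons_max; apply: contra_neq ya0 => <- /=.
congr (horner _ _); apply: eq_map_poly => c; apply: meval_eq => i.
by rewrite ffun_rcons_widen.
Qed.

End Footprint.

(** Every generator ['X_i ^+ #|F|.-1 - 1] of the ideal vanishes where all coordinates are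
    nonzero. *)
Lemma meval_red (F : finFieldType) (n : nat) (p : {mpoly F[n]}) (x : 'I_n -> F) :
  (forall i, x i != 0) -> (mpoly_red #|F| p).@[x] = p.@[x].
Proof.
move=> x0; have [B e] := congr_red #|F| p; apply/esym/eqP.
rewrite -subr_eq0 -mevalB e rmorph_sum big1 //= => i _.
rewrite mevalM mevalB meval1 rmorphXn /= mevalXU.
suff -> : x i ^+ #|F|.-1 = 1 by rewrite subrr mulr0.
apply: (mulfI (x0 i)); rewrite -exprS prednK ?expf_card ?mulr1 //.
exact: ltnW (card_finNzRing_gt1 F).
Qed.

Theorem theorem6 (q n : nat) (F : finFieldType) (P : {mpoly F[n]}) (m : nat) :
  #|F| = q -> (0 < n)%N ->
  P != 0 -> (forall i : 'I_n, (mdeg_in i P < q.-1)%N) ->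
  m = #|[set x : {ffun 'I_n -> F} | [forall i, x i != 0] && (P.@[x] != 0)]| ->
  ~ exists k : 'X_{1..n},
      (forall i : 'I_n, (k i <= q - 2)%N) /\
      [predI msupp (mpoly_red q ('X_[k] * P)) & monU q m n] =i pred0.
Proof.
move=> <-{q} _ P0 degP mE [k [_ disj]].
pose A : {set F} := [set~ 0].
have cardA : #|A| = #|F|.-1 by exact: cardsC1.
set Q := mpoly_red _ _ in disj.
have gridE (p : {mpoly F[n]}) : grid_nonzeros F A n p =
    [set x : {ffun 'I_n -> F} | [forall i, x i != 0] && (p.@[x] != 0)].
  apply/setP => x; rewrite !inE; congr andb; apply: eq_forallb => i.
  by rewrite in_setC1.
have gridQ : grid_nonzeros F A n Q = grid_nonzeros F A n P.
  apply/setP => x; rewrite !gridE !inE; apply: andb_id2l => /forallP x0.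
  rewrite meval_red // mevalM mulf_eq0 mevalX negb_or andb_idl // => _.
  by apply/prodf_neq0 => i _; rewrite expf_neq0.
have Q0 : Q != 0.
  have [mon monP le_mon] := footprint_bound F A n P P0.
  have : (0 < #|grid_nonzeros F A n P|)%N.
    (* Each factor is positive because the exponents of [P] stay below [q - 1]. *)
    apply: leq_trans le_mon; rewrite prodn_gt0 // => i; rewrite cardA subn_gt0.
    have d0 := leq_ltn_trans (leq0n _) (degP i).
    by have /(mdeg_in_ltP _ _ d0) := degP i; apply.
  rewrite -gridQ card_gt0; apply: contraNneq => ->.
  by apply/eqP/setP => x; rewrite !inE meval0 eqxx andbF.
have [mon monQ le_mon] := footprint_bound F A n Q Q0.
have := disj mon; rewrite !inE monQ mE -gridE -gridQ -cardA le_mon andbT /=.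
(* The product bound holds, so contradicting [disj] only takes exponents below [q - 1], which
   reduction ensures. *)
move/forallP; apply => i; rewrite cardA.
have q1 := card_finNzRing_gt1 F.
have d0 : (0 < #|F|.-1)%N by rewrite -subn1 subn_gt0.
by have /(mdeg_in_ltP _ _ d0) := mdeg_in_red ('X_[k] * P) i q1; apply.
Qed.
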